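(* Let $R$ be a ring, and let $a,b,c\in R$ satisfy $$(aba)b=(aca)b,\quad b(aba)=b(aca),\quad (aba)c=(aca)c,\quad c(aba)=c(aca).$$ If $ac\in R^{\#}$, then $(ba)^2\in R^{\#}$. In this case, $$(ac)^{\#}=a\big[(ba)^2\big]^{\#}c.$$
   Context: All rings are associative with an identity. The group inverse of $a\in R$ is the unique element $a^{\#}\in R$ (if it exists) satisfying $aa^{\#}=a^{\#}a$, $a=aa^{\#}a$ and $a^{\#}=a^{\#}aa^{\#}$. $R^{\#}$ denotes the set of all group invertible elements of $R$. *)

(* Defs.v *)
From mathcomp Require Import all_boot all_algebra.

Set Implicit Arguments.
Unset Strict Implicit.
Unset Printing Implicit Defensive.

Import GRing.Theory.
Local Open Scope ring_scope.

(* [pzRingType] rather than [nzRingType]: the zero ring is not excluded. *)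

Definition is_group_inverse (R : pzRingType) (a x : R) : Prop :=
  [/\ a * x = x * a, a = a * x * a & x = x * a * x].

Definition group_invertible (R : pzRingType) (a : R) : Prop :=
  exists x : R, is_group_inverse a x.

Lemma is_group_inverse_unique (R : pzRingType) (a x y : R) :
  is_group_inverse a x -> is_group_inverse a y -> x = y.
Proof.
move=> [axC axa xax] [ayC aya yay].
have axy : a * x = a * y.
  by rewrite {1}aya -mulrA axC ayC -!mulrA (mulrA a x a) -axa.
by rewrite xax -mulrA axy mulrA -axC axy ayC -yay.
Qed.

(* Main.v *)
(* The group inverse of [(b a)^2] is [b g^3 a] with [g] the group inverse of
   [a c]. Since [g] is a multiple of [a c] on either side, the hypotheses give
   [(a b) g = (a c) g] and [g (a b a) = g (a c a)]; these turn every [b] standing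
   between an [a] and a power of [g] into a [c], and powers of [a c] then cancel
   against powers of [g]. *)

Require Import Defs.
From mathcomp Require Import all_boot all_algebra.

Set Implicit Arguments.
Unset Strict Implicit.
Unset Printing Implicit Defensive.

Import GRing.Theory.
Local Open Scope ring_scope.

Section GroupInverseSwap.

Variables (R : pzRingType) (a b c g : R).
Hypothesis gP : is_group_inverse (a * c) g.

Lemma group_inverse_swapl :
  a * b * a * c = a * c * a * c -> a * b * g = a * c * g.
Proof.
move=> h3; have [gC _ gag] := gP.
(* Factoring [g] as [a c g^2] puts [a c] right after [a b], where the hypothesis applies. *)
have -> : g = a * c * g * g by rewrite gC -gag.
by rewrite !mulrA h3.
Qed.

Lemma group_inverse_swapr :
  c * (a * b * a) = c * (a * c * a) -> g * (a * b * a) = g * (a * c * a).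
Proof.
move=> h4; have [gC _ gag] := gP.
have -> : g = g * g * a * c by rewrite {1}gag -mulrA gC !mulrA.
by rewrite -!(mulrA _ c (_ * a)) h4.
Qed.

Lemma is_group_inverse_sqr_swap :
  b * (a * b * a) = b * (a * c * a) ->
  a * b * a * c = a * c * a * c ->
  c * (a * b * a) = c * (a * c * a) ->
  is_group_inverse ((b * a) ^+ 2) (b * g ^+ 3 * a).
Proof.
move=> h2 h3 h4; have [gC aga gag] := gP.
(* The leading factor [x] lets these rewrite inside left-associated products. *)
have swapl x : x * a * b * g = x * a * c * g.
  by rewrite -!mulrA !(mulrA a) group_inverse_swapl.
have swapr x : x * g * a * b * a = x * g * a * c * a.
  by have := congr1 ( *%R x) (group_inverse_swapr h4); rewrite !mulrA.
have comm x : x * g * a * c = x * a * c * g.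
  by have := congr1 ( *%R x) gC; rewrite !mulrA.
have acgg x : x * a * c * g * g = x * g.
  by have := congr1 ( *%R x) gag; rewrite !mulrA comm.
have acacg x : x * a * c * a * c * g = x * a * c.
  by have := congr1 ( *%R x) aga; rewrite !mulrA comm.
have -> : (b * a) ^+ 2 = b * a * b * a by rewrite expr2 mulrA.
have -> : b * g ^+ 3 * a = b * g * g * g * a by rewrite !exprS expr0 mulr1 !mulrA.
(* Both products equal the idempotent [b g a]: each swap creates an [a c], which is absorbed through
   [a c g^2 = g]. *)
have wh : b * a * b * a * (b * g * g * g * a) = b * g * a.
  by rewrite !mulrA swapl acgg swapl acgg.
have hw : b * g * g * g * a * (b * a * b * a) = b * g * a.
  by rewrite !mulrA swapr comm comm acgg swapr comm comm acgg.
split.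
- by rewrite wh hw.
(* The product [b g a (b a)^2] collapses to [b (a c a)], which [h2] turns back into [(b a)^2]. *)
- by rewrite wh !mulrA swapr comm swapr comm acacg; have := h2; rewrite !mulrA.
- by rewrite hw !mulrA swapl acgg.
Qed.

End GroupInverseSwap.

Theorem theorem2p7 (R : pzRingType) (a b c : R)
  (h1 : (a * b * a) * b = (a * c * a) * b)
  (h2 : b * (a * b * a) = b * (a * c * a))
  (h3 : (a * b * a) * c = (a * c * a) * c)
  (h4 : c * (a * b * a) = c * (a * c * a))
  (hac : group_invertible (a * c)) :
  group_invertible ((b * a) ^+ 2) /\
  (forall g h : R,
     is_group_inverse (a * c) g -> is_group_inverse ((b * a) ^+ 2) h ->
     g = a * h * c).
Proof.
have [g0 g0P] := hac.
split; first by exists (b * g0 ^+ 3 * a); exact: (is_group_inverse_sqr_swap g0P).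
move=> g h gP hP.
(* Uniqueness replaces [h] by the explicit inverse [b g^3 a]. *)
rewrite (is_group_inverse_unique hP (is_group_inverse_sqr_swap gP h2 h3 h4)).
have [gC _ gag] := gP.
have -> : a * (b * g ^+ 3 * a) * c = a * b * g * g * g * (a * c).
  by rewrite !exprS expr0 mulr1 !mulrA.
(* After the swap, [a c g^3 a c] has two factors [a c] to cancel against [g^3], leaving [g]. *)
by rewrite (group_inverse_swapl gP h3) gC -gag -mulrA -gC mulrA -gag.
Qed.
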